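(* Consider the $\beta$-plane problem with centripetal forces and surface tension (system (E), incompressibility (M), boundary conditions (B1)–(B3) as set out in the context). Assume that the vorticity vector $\mathbf{\Upsilon}=(\Upsilon_1,\Upsilon_2,\Upsilon_3)$ is constant and satisfies $\Upsilon_2+\hat f\neq0$. Then there is no bounded solution $(u,v,w,P,\eta)$ of (E), (M), (B1), (B2), (B3).
   Context: Constants: $\Omega>0$ (rotational speed of the Earth), $R>0$ (radius of the Earth), $g>0$ (gravitational acceleration), $\rho>0$ (constant water density), $P_{atm}$ (constant atmospheric pressure), $\sigma>0$ (surface tension coefficient), $d>0$ (the flat bed is $z=-d$), $c>0$ (wave speed), $L>0$ (wave period). The latitude $\phi\in(-\pi/2,\pi/2)$ is fixed, and $f=2\Omega\sin\phi$, $\hat f=2\Omega\cos\phi\neq0$, $\beta=\hat f/R$ are constants. Free surface and fluid domain: the free surface is $z=\eta(x-ct)$, where $\eta$ is an $L$-periodic function of one real variable, of class $C^2$, with $\eta>-d$ and zero mean $\int_0^L\eta(s)\,ds=0$; the wave crest (maximum of $\eta$) is located at $0$ and $\eta(0)>0$. The surface does not depend on $y$. The fluid domain at time $t$ is $\{(x,y,z): x,y\in\mathbb{R},\ -d\le z\le \eta(x-ct)\}$. The velocity field $\mathbf{u}=(u,v,w)$ and the pressure $P$ are functions of $(x,y,z,t)$, sufficiently smooth (classical) in the fluid domain up to its boundary. (E) ($\beta$-plane equations with centripetal terms): $$u_t+uu_x+vu_y+wu_z+\hat f w-(f+\beta y)v=-\tfrac1\rho P_x,$$ $$v_t+uv_x+vv_y+wv_z+(f+\beta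 y)u+\tfrac{\hat f^2}{4}y+\tfrac{\hat f f}{4}R=-\tfrac1\rho P_y,$$ $$w_t+uw_x+vw_y+ww_z-\hat f u-\tfrac{\hat f^2}{4}R=-\tfrac1\rho P_z-g.$$ (M) (incompressibility): $u_x+v_y+w_z=0$. (B1) (dynamic condition with surface tension): $P=P_{atm}-\sigma\,\dfrac{\eta_{xx}}{(1+\eta_x^2)^{3/2}}$ on $z=\eta(x-ct)$. (B2) $w=(u-c)\eta_x$ on $z=\eta(x-ct)$. (B3) $w=0$ on $z=-d$. The vorticity vector is $\mathbf{\Upsilon}=(\Upsilon_1,\Upsilon_2,\Upsilon_3)=(w_y-v_z,\ u_z-w_x,\ v_x-u_y)$; ''constant'' means that it does not depend on $(x,y,z,t)$. A solution is called bounded if its velocity field $(u,v,w)$ is bounded on the fluid domain. *)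

(* Defs.v *)
From Stdlib Require Export Reals.
From Coquelicot Require Export Coquelicot.
Open Scope R_scope.

(* A scalar field, as a function of [x y z t].  Fields are total functions;
   only their values on the fluid domain are ever constrained or used. *)
Definition field := R -> R -> R -> R -> R.

Definition Dx (F : field) : field := fun x y z t => Derive (fun s => F s y z t) x.
Definition Dy (F : field) : field := fun x y z t => Derive (fun s => F x s z t) y.
Definition Dz (F : field) : field := fun x y z t => Derive (fun s => F x y s t) z.
Definition Dt (F : field) : field := fun x y z t => Derive (fun s => F x y z s) t.

Definition coriolis_f (Omega phi : R) : R := 2 * Omega * sin phi.
Definition coriolis_fhat (Omega phi : R) : R := 2 * Omega * cos phi.

(* The time-dependent fluid domain and its interior. *)
Definition fluid (d c : R) (eta : R -> R) (x y z t : R) : Prop :=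
  - d <= z <= eta (x - c * t).
Definition fluid_int (d c : R) (eta : R -> R) (x y z t : R) : Prop :=
  - d < z < eta (x - c * t).

Definition C2 (h : R -> R) : Prop :=
  forall s, ex_derive h s /\ ex_derive (Derive h) s /\
            continuous (Derive (Derive h)) s.

Definition wave_profile (d L : R) (eta : R -> R) : Prop :=
  C2 eta /\
  (forall s, eta (s + L) = eta s) /\
  (forall s, - d < eta s) /\
  RInt eta 0 L = 0 /\
  (forall s, eta s <= eta 0) /\
  0 < eta 0.

Definition field_continuous_on (D : R -> R -> R -> R -> Prop) (F : field) : Prop :=
  continuous_on (fun p : R * R * R * R => let '(x, y, z, t) := p in D x y z t)
                (fun p : R * R * R * R => let '(x, y, z, t) := p in F x y z t).

(* Class C^k up to the boundary: [F] is continuous on the closed domain [D] and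
   its partial derivatives of order at most [k] in the interior [I] are
   restrictions of functions continuous on [D].  The extensions [Fx], [Fy],
   [Fz], [Ft] are needed because [Derive] at a boundary point would depend on
   values outside [D]. *)
Fixpoint Ck_upto (I D : R -> R -> R -> R -> Prop) (k : nat) (F : field) : Prop :=
  field_continuous_on D F /\
  match k with
  | O => True
  | S k' =>
      exists Fx Fy Fz Ft : field,
        (forall x y z t, I x y z t ->
           is_derive (fun s => F s y z t) x (Fx x y z t) /\
           is_derive (fun s => F x s z t) y (Fy x y z t) /\
           is_derive (fun s => F x y s t) z (Fz x y z t) /\
           is_derive (fun s => F x y z s) t (Ft x y z t)) /\
        Ck_upto I D k' Fx /\ Ck_upto I D k' Fy /\
        Ck_upto I D k' Fz /\ Ck_upto I D k' Ft
  end.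

(* Enough for the equations, and the vorticity equation obtained as their curl,
   to make sense classically; every higher smoothness class is included. *)
Definition classical_regularity (d c : R) (eta : R -> R) (u v w P : field) : Prop :=
  Ck_upto (fluid_int d c eta) (fluid d c eta) 2 u /\
  Ck_upto (fluid_int d c eta) (fluid d c eta) 2 v /\
  Ck_upto (fluid_int d c eta) (fluid d c eta) 2 w /\
  Ck_upto (fluid_int d c eta) (fluid d c eta) 1 P.

Definition material (u v w F : field) : field := fun x y z t =>
  Dt F x y z t + u x y z t * Dx F x y z t
  + v x y z t * Dy F x y z t + w x y z t * Dz F x y z t.

(* The field equations are imposed in the interior; under
   [classical_regularity] they then hold up to the boundary by continuity. *)
Definition momentum (f fhat Rad g rho d c : R) (eta : R -> R)
    (u v w P : field) : Prop :=
  let beta := fhat / Rad in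
  forall x y z t, fluid_int d c eta x y z t ->
    material u v w u x y z t + fhat * w x y z t - (f + beta * y) * v x y z t
      = - (1 / rho) * Dx P x y z t /\
    material u v w v x y z t + (f + beta * y) * u x y z t
        + fhat ^ 2 / 4 * y + fhat * f / 4 * Rad
      = - (1 / rho) * Dy P x y z t /\
    material u v w w x y z t - fhat * u x y z t - fhat ^ 2 / 4 * Rad
      = - (1 / rho) * Dz P x y z t - g.

Definition incompressible (d c : R) (eta : R -> R) (u v w : field) : Prop :=
  forall x y z t, fluid_int d c eta x y z t ->
    Dx u x y z t + Dy v x y z t + Dz w x y z t = 0.

Definition constant_vorticity (d c : R) (eta : R -> R) (u v w : field)
    (Y1 Y2 Y3 : R) : Prop :=
  forall x y z t, fluid_int d c eta x y z t ->
    Dy w x y z t - Dz v x y z t = Y1 /\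
    Dz u x y z t - Dx w x y z t = Y2 /\
    Dx v x y z t - Dy u x y z t = Y3.

Definition dynamic_surface (Patm sigma c : R) (eta : R -> R) (P : field) : Prop :=
  forall x y t, let s := x - c * t in
    P x y (eta s) t
      = Patm - sigma * (Derive (Derive eta) s
                        / Rpower (1 + (Derive eta s) ^ 2) (3 / 2)).

Definition kinematic_surface (c : R) (eta : R -> R) (u w : field) : Prop :=
  forall x y t, let s := x - c * t in
    w x y (eta s) t = (u x y (eta s) t - c) * Derive eta s.

Definition kinematic_bed (d : R) (w : field) : Prop :=
  forall x y t, w x y (- d) t = 0.

(* The bound may depend on [t]: boundedness on the fluid domain at each time.
   This includes the velocity fields bounded uniformly in time. *)
Definition bounded_velocity (d c : R) (eta : R -> R) (u v w : field) : Prop :=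
  forall t, exists M, forall x y z, fluid d c eta x y z t ->
    Rabs (u x y z t) <= M /\ Rabs (v x y z t) <= M /\ Rabs (w x y z t) <= M.

Definition solution (Omega Rad g rho Patm sigma d c L phi : R)
    (u v w P : field) (eta : R -> R) : Prop :=
  wave_profile d L eta /\
  classical_regularity d c eta u v w P /\
  momentum (coriolis_f Omega phi) (coriolis_fhat Omega phi) Rad g rho d c eta
    u v w P /\
  incompressible d c eta u v w /\
  dynamic_surface Patm sigma c eta P /\
  kinematic_surface c eta u w /\
  kinematic_bed d w.

(* Main.v *)
Require Import Defs.
From Stdlib Require Import Classical Lra.

(* Write [h] for [fhat], [beta = h / Rad], and let
   [W = (Y1, Y2 + h, Y3 + f + beta y)] be the absolute vorticity.  Since the
   vorticity is constant, the curl of the momentum equations is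
   [(W . grad) (u, v, w) = (0, 0, beta v)].  This makes the gradient of
   [phi = W . (u, v, w)] explicit:
     [grad phi = (h Y3 - Y2 (f + beta y), Y1 (f + beta y) + beta w, beta v - h Y1)].
   As [beta <> 0], equality of the mixed partials of [phi] gives [w_x = - Y2],
   [v_x = 0] and [v_y = w_z], whence [u_z = 0], [u_y = - Y3] and [u_x = - 2 v_y].
   The fluid domain contains whole lines in the direction [y], so boundedness
   kills the constant slopes along them: [Y3 = 0], then [v_y = 0], then [v_z = 0]
   and [Y1 = 0], and the third vorticity equation leaves [v = 0].  Now [w_z = 0]
   and [w = 0] on the bed, so [w = 0].  Where the surface has a nonzero slope the
   kinematic condition gives [u = c], and there
     [P_y = - rho ((f + beta y) c + h^2 y / 4 + h f Rad / 4)],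
   whereas the pressure on the surface does not depend on [y]:
   [beta c + h^2 / 4] would have to vanish. *)

(** * Symmetry of mixed partial derivatives *)

(** Coquelicot's [Schwarz] speaks of iterated [Derive] terms near the point. Openness of [U]
    identifies them locally with the named derivatives, and continuity carries over. *)
Lemma schwarz_2d (U : R -> R -> Prop) (f fx fy fxy fyx : R -> R -> R) (x y : R) :
  (forall a b, U a b -> locally_2d U a b) ->
  (forall a b, U a b ->
     is_derive (fun s => f s b) a (fx a b) /\
     is_derive (fun s => f a s) b (fy a b) /\
     is_derive (fun s => fx a s) b (fxy a b) /\
     is_derive (fun s => fy s b) a (fyx a b)) ->
  U x y -> continuity_2d_pt fxy x y -> continuity_2d_pt fyx x y ->
  fxy x y = fyx x y.
Proof.
intros HU HD Hxy Cxy Cyx.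
assert (L : forall a b, U a b -> locally a (fun s => U s b) /\ locally b (U a)).
{ intros a b Hab; destruct (HU a b Hab) as [e He]; split; exists e; intros s Hs;
    apply He; try exact Hs; rewrite Rminus_diag, Rabs_R0; apply cond_pos. }
assert (Exy : forall a b, U a b ->
  is_derive (fun s => Derive (fun r => f r s) a) b (fxy a b)).
{ intros a b Hab; apply is_derive_ext_loc with (fun s => fx a s); [|now apply HD].
  generalize (proj2 (L a b Hab)); apply filter_imp; intros s Hs.
  symmetry; apply is_derive_unique; now apply HD. }
assert (Eyx : forall a b, U a b ->
  is_derive (fun s => Derive (fun r => f s r) b) a (fyx a b)).
{ intros a b Hab; apply is_derive_ext_loc with (fun s => fy s b); [|now apply HD].
  generalize (proj1 (L a b Hab)); apply filter_imp; intros s Hs.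
  symmetry; apply is_derive_unique; now apply HD. }
rewrite <- (is_derive_unique _ _ _ (Exy x y Hxy)).
rewrite <- (is_derive_unique _ _ _ (Eyx x y Hxy)).
symmetry; apply Schwarz.
- generalize (HU x y Hxy); apply locally_2d_impl; apply locally_2d_forall.
  intros a b Hab; destruct (HD a b Hab) as (D1 & D2 & _ & _).
  repeat split; eexists;
    [exact D1 | exact D2 | exact (Eyx a b Hab) | exact (Exy a b Hab)].
- apply continuity_2d_pt_ext_loc with fyx; [|exact Cyx].
  generalize (HU x y Hxy); apply locally_2d_impl; apply locally_2d_forall.
  intros a b Hab; symmetry; apply is_derive_unique; now apply Eyx.
- apply continuity_2d_pt_ext_loc with fxy; [|exact Cxy].
  generalize (HU x y Hxy); apply locally_2d_impl; apply locally_2d_forall.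
  intros a b Hab; symmetry; apply is_derive_unique; now apply Exy.
Qed.

Definition region := R -> R -> R -> R -> Prop.

(** Passes from curried fields and regions to the product space, where [open] and [continuous] make
    sense. *)
Definition uncurry4 {A : Type} (F : R -> R -> R -> R -> A) (p : R * R * R * R) : A :=
  let '(x, y, z, t) := p in F x y z t.

Definition region_open (I : region) : Prop := open (uncurry4 I).

Definition continuous_in (I : region) (F : field) : Prop :=
  forall p, uncurry4 I p -> continuous (uncurry4 F) p.

Inductive axis := axis_x | axis_y | axis_z | axis_t.

Definition is_partial (I : region) (i : axis) (F G : field) : Prop :=
  forall x y z t, I x y z t ->
    match i with
    | axis_x => is_derive (fun s => F s y z t) x (G x y z t)
    | axis_y => is_derive (fun s => F x s z t) y (G x y z t)
    | axis_z => is_derive (fun s => F x y s t) z (G x y z t)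
    | axis_t => is_derive (fun s => F x y z s) t (G x y z t)
    end.

(** Reduces symmetry in four variables to the plane: [sig] stands for the embedding of two
    coordinates with the other two frozen, so one argument serves every pair of axes. *)
Lemma mixed_partials_slice (I : region) (sig : R -> R -> R * R * R * R)
    (F Fi Fj Fij Fji : field) (a b : R) :
  region_open I ->
  (forall r s, filterlim (fun q : R * R => sig (fst q) (snd q))
                 (locally (r, s)) (locally (sig r s))) ->
  (forall r s, uncurry4 I (sig r s) ->
     is_derive (fun h => uncurry4 F (sig h s)) r (uncurry4 Fi (sig r s)) /\
     is_derive (fun h => uncurry4 F (sig r h)) s (uncurry4 Fj (sig r s)) /\
     is_derive (fun h => uncurry4 Fi (sig r h)) s (uncurry4 Fij (sig r s)) /\
     is_derive (fun h => uncurry4 Fj (sig h s)) r (uncurry4 Fji (sig r s))) ->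
  continuous_in I Fij -> continuous_in I Fji ->
  uncurry4 I (sig a b) -> uncurry4 Fij (sig a b) = uncurry4 Fji (sig a b).
Proof.
intros HI Hs HD C1 C2 H.
apply (schwarz_2d (fun r s => uncurry4 I (sig r s))
  (fun r s => uncurry4 F (sig r s))
  (fun r s => uncurry4 Fi (sig r s)) (fun r s => uncurry4 Fj (sig r s))
  (fun r s => uncurry4 Fij (sig r s)) (fun r s => uncurry4 Fji (sig r s)));
  try assumption.
- intros r s Hrs; apply locally_2d_locally, (Hs r s), HI, Hrs.
- apply continuity_2d_pt_filterlim.
  exact (filterlim_comp _ _ _ _ (uncurry4 Fij) _ _ _ (Hs a b) (C1 _ H)).
- apply continuity_2d_pt_filterlim.
  exact (filterlim_comp _ _ _ _ (uncurry4 Fji) _ _ _ (Hs a b) (C2 _ H)).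
Qed.

Lemma mixed_partials (I : region) (i j : axis) (F Fi Fj Fij Fji : field) :
  region_open I -> i <> j ->
  is_partial I i F Fi -> is_partial I j F Fj ->
  is_partial I j Fi Fij -> is_partial I i Fj Fji ->
  continuous_in I Fij -> continuous_in I Fji ->
  forall x y z t, I x y z t -> Fij x y z t = Fji x y z t.
Proof.
intros HI Hij H1 H2 H3 H4 C1 C2 x y z t H.
pose (Schw sig := mixed_partials_slice I sig F Fi Fj Fij Fji).
destruct i, j; try (now elim Hij);
(* One plane for each ordered pair of distinct axes: [r] runs along [i] and [s] along [j]. *)
[ apply (Schw (fun r s : R => (r, s, z, t)) x y)
| apply (Schw (fun r s : R => (r, y, s, t)) x z)
| apply (Schw (fun r s : R => (r, y, z, s)) x t)
| apply (Schw (fun r s : R => (s, r, z, t)) y x)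
| apply (Schw (fun r s : R => (x, r, s, t)) y z)
| apply (Schw (fun r s : R => (x, r, z, s)) y t)
| apply (Schw (fun r s : R => (s, y, r, t)) z x)
| apply (Schw (fun r s : R => (x, s, r, t)) z y)
| apply (Schw (fun r s : R => (x, y, r, s)) z t)
| apply (Schw (fun r s : R => (s, y, z, r)) t x)
| apply (Schw (fun r s : R => (x, s, z, r)) t y)
| apply (Schw (fun r s : R => (x, y, s, r)) t z) ];
try assumption;
solve
[ intros r s Q [e He]; exists e; intros [r' s'] [Hr Hs]; apply He;
  repeat split; try assumption; apply ball_center
| intros r s Hrs;
  exact (conj (H1 _ _ _ _ Hrs) (conj (H2 _ _ _ _ Hrs)
          (conj (H3 _ _ _ _ Hrs) (H4 _ _ _ _ Hrs)))) ].
Qed.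

(** * Calculus of partial derivatives in an open region *)

Lemma locally_uncurry4 (Q : region) x y z t :
  locally (x, y, z, t) (uncurry4 Q) ->
  locally x (fun s => Q s y z t) /\ locally y (fun s => Q x s z t) /\
  locally z (fun s => Q x y s t) /\ locally t (fun s => Q x y z s).
Proof.
intros [e He]; repeat split; exists e; intros s Hs;
  [ apply (He (s, y, z, t)) | apply (He (x, s, z, t))
  | apply (He (x, y, s, t)) | apply (He (x, y, z, s)) ];
  repeat split; try assumption; apply ball_center.
Qed.

(** A derivative depends on nearby values; as [I] is open, equality on [I] covers them. *)
Lemma is_partial_ext (I : region) (i : axis) (F F' G G' : field) :
  region_open I ->
  (forall x y z t, I x y z t -> F x y z t = F' x y z t) ->
  (forall x y z t, I x y z t -> G x y z t = G' x y z t) ->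
  is_partial I i F G -> is_partial I i F' G'.
Proof.
intros HI HF HG H x y z t Hp; specialize (H x y z t Hp).
destruct (locally_uncurry4 I x y z t (HI (x, y, z, t) Hp)) as (L1 & L2 & L3 & L4).
rewrite <- (HG _ _ _ _ Hp).
destruct i; (eapply is_derive_ext_loc; [|exact H]);
  [revert L1 | revert L2 | revert L3 | revert L4];
  apply filter_imp; intros s; apply HF.
Qed.

Lemma is_partial_unique (I : region) (i : axis) (F G G' : field) :
  is_partial I i F G -> is_partial I i F G' ->
  forall x y z t, I x y z t -> G x y z t = G' x y z t.
Proof.
intros H H' x y z t Hp; specialize (H x y z t Hp); specialize (H' x y z t Hp).
destruct i; rewrite <- (is_derive_unique _ _ _ H); now apply is_derive_unique.
Qed.

Lemma is_partial_const (I : region) (i : axis) (k : R) :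
  is_partial I i (fun _ _ _ _ => k) (fun _ _ _ _ => 0).
Proof. intros x y z t _; destruct i; apply (is_derive_const k). Qed.

Definition if_y (i : axis) : R := match i with axis_y => 1 | _ => 0 end.
Definition if_z (i : axis) : R := match i with axis_z => 1 | _ => 0 end.

Lemma is_partial_coord_y (I : region) (i : axis) :
  is_partial I i (fun _ y _ _ => y) (fun _ _ _ _ => if_y i).
Proof.
intros x y z t _; destruct i; try apply (is_derive_const y); apply (is_derive_id y).
Qed.

Lemma is_partial_coord_z (I : region) (i : axis) :
  is_partial I i (fun _ _ z _ => z) (fun _ _ _ _ => if_z i).
Proof.
intros x y z t _; destruct i; try apply (is_derive_const z); apply (is_derive_id z).
Qed.

Lemma is_partial_plus (I : region) (i : axis) (F F' G G' : field) :
  is_partial I i F F' -> is_partial I i G G' ->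
  is_partial I i (fun x y z t => F x y z t + G x y z t)
    (fun x y z t => F' x y z t + G' x y z t).
Proof.
intros HF HG x y z t Hp; specialize (HF x y z t Hp); specialize (HG x y z t Hp).
destruct i; exact (is_derive_plus _ _ _ _ _ HF HG).
Qed.

Lemma is_partial_mult (I : region) (i : axis) (F F' G G' : field) :
  is_partial I i F F' -> is_partial I i G G' ->
  is_partial I i (fun x y z t => F x y z t * G x y z t)
    (fun x y z t => F' x y z t * G x y z t + F x y z t * G' x y z t).
Proof.
intros HF HG x y z t Hp; specialize (HF x y z t Hp); specialize (HG x y z t Hp).
destruct i; exact (is_derive_mult _ _ _ _ _ HF HG Rmult_comm).
Qed.

Lemma continuous_in_const (I : region) (k : R) : continuous_in I (fun _ _ _ _ => k).
Proof.
intros [[[x y] z] t] _.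
apply continuous_ext with (fun _ => k); [now intros [[[? ?] ?] ?]|].
apply continuous_const.
Qed.

Lemma continuous_in_coord_y (I : region) : continuous_in I (fun _ y _ _ => y).
Proof.
intros [[[x y] z] t] _.
apply continuous_ext with (fun p => snd (fst (fst p))); [now intros [[[? ?] ?] ?]|].
apply continuous_comp with (f := fun p : R * R * R * R => fst (fst p)) (g := snd);
  [|apply continuous_snd].
apply continuous_comp with (f := fun p : R * R * R * R => fst p) (g := fst);
  apply continuous_fst.
Qed.

Lemma continuous_in_plus (I : region) (F G : field) :
  continuous_in I F -> continuous_in I G ->
  continuous_in I (fun x y z t => F x y z t + G x y z t).
Proof.
intros HF HG p Hp.
apply continuous_ext with (fun p => plus (uncurry4 F p) (uncurry4 G p));
  [now intros [[[? ?] ?] ?]|].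
apply @continuous_plus; [apply HF | apply HG]; exact Hp.
Qed.

Lemma continuous_in_mult (I : region) (F G : field) :
  continuous_in I F -> continuous_in I G ->
  continuous_in I (fun x y z t => F x y z t * G x y z t).
Proof.
intros HF HG p Hp.
apply continuous_ext with (fun p => mult (uncurry4 F p) (uncurry4 G p));
  [now intros [[[? ?] ?] ?]|].
apply @continuous_mult; [apply HF | apply HG]; exact Hp.
Qed.

Definition jet1 (I : region) (F : field) (D : axis -> field) : Prop :=
  (forall i, is_partial I i F (D i)) /\ continuous_in I F /\
  forall i, continuous_in I (D i).

(** [DD i j] differentiates along [i] first and then along [j]. *)
Definition jet2 (I : region) (F : field) (D : axis -> field)
    (DD : axis -> axis -> field) : Prop :=
  jet1 I F D /\ forall i, jet1 I (D i) (DD i).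

Lemma jet1_Derive (I : region) (F : field) (D : axis -> field) (x y z t : R) :
  jet1 I F D -> I x y z t ->
  Dx F x y z t = D axis_x x y z t /\ Dy F x y z t = D axis_y x y z t /\
  Dz F x y z t = D axis_z x y z t /\ Dt F x y z t = D axis_t x y z t.
Proof.
intros [HD _] Hp; repeat split; apply is_derive_unique;
  [ apply (HD axis_x) | apply (HD axis_y) | apply (HD axis_z) | apply (HD axis_t) ];
  exact Hp.
Qed.

(** * Invariance and constant slopes along coordinate lines *)

Definition y_invariant (I : region) : Prop :=
  forall x y y' z t, I x y z t -> I x y' z t.

Lemma partial_y_invariant (I : region) (i : axis) (F G : field) :
  region_open I -> y_invariant I -> is_partial I i F G -> i <> axis_y ->
  is_partial I axis_y F (fun _ _ _ _ => 0) ->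
  forall x y y' z t, I x y z t -> G x y z t = G x y' z t.
Proof.
intros HI Hinv HF Hi H0 x y y' z t Hp.
apply (is_partial_unique I i F G (fun x _ z t => G x y' z t)); trivial.
apply is_partial_ext with (fun x _ z t => F x y' z t) (fun x _ z t => G x y' z t);
  trivial.
- intros a b e s Ha.
  destruct (Rtotal_order b y') as [Hlt | [-> | Hlt]]; trivial;
    [symmetry|]; apply (eq_is_derive (fun r => F a r e s)); trivial;
    intros r _; apply (H0 a r e s), (Hinv a b), Ha.
- intros a b e s Ha; apply (Hinv a b y') in Ha; specialize (HF _ _ _ _ Ha).
  destruct i; trivial; now elim Hi.
Qed.

Lemma derive_const_affine (g : R -> R) (k : R) :
  (forall s, is_derive g s k) -> forall s, g s = g 0 + k * s.
Proof.
intros Hg s.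
assert (Hd : forall r, is_derive (fun r => g r - k * r) r 0).
{ intros r; replace 0 with (k - k * 1) by ring.
  apply (is_derive_minus g (fun r => k * r)); [apply Hg|].
  apply (is_derive_scal (fun r => r)); apply (is_derive_id r). }
destruct (Rtotal_order s 0) as [H | [-> | H]]; [| ring |];
  apply (eq_is_derive (fun r => g r - k * r)) in H; try (intros; apply Hd); lra.
Qed.

Lemma bounded_derive_const (g : R -> R) (k M : R) :
  (forall s, is_derive g s k) -> (forall s, Rabs (g s) <= M) -> k = 0.
Proof.
intros Hg HM; destruct (Req_dec k 0) as [|Hk]; trivial; exfalso.
(* At this [s] the linear term is [2 * M + 1], more than the largest possible difference [2 * M] of
   two values of [g]. *)
pose (s := (2 * M + 1) / k).
assert (Hs := derive_const_affine g k Hg s).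
replace (k * s) with (2 * M + 1) in Hs by (unfold s; field; exact Hk).
assert (H1 := HM s); assert (H0 := HM 0).
apply Rabs_le_between in H1; apply Rabs_le_between in H0; lra.
Qed.

Lemma is_partial_line_y (I : region) (F G : field) (x z t k : R) :
  is_partial I axis_y F G -> (forall y, I x y z t) ->
  (forall y, G x y z t = k) -> forall y, is_derive (fun s => F x s z t) y k.
Proof. intros H Hp Hk y; rewrite <- (Hk y); apply H, Hp. Qed.

Lemma is_partial_line_z (I : region) (F : field) (x y t lo hi : R) :
  is_partial I axis_z F (fun _ _ _ _ => 0) ->
  (forall z, lo < z < hi -> I x y z t) ->
  forall z z', lo < z < hi -> lo < z' < hi -> F x y z t = F x y z' t.
Proof.
intros H Hp z z' Hz Hz'.
destruct (Rtotal_order z z') as [Hlt | [-> | Hlt]]; trivial; [|symmetry];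
  apply (eq_is_derive (fun s => F x y s t)); trivial;
  intros s Hs; apply (H x y s t), Hp; lra.
Qed.

(** * Regularity of the fluid domain *)

Lemma closed_interval_limit (g : R -> R) (lo hi z0 k : R) :
  lo < hi -> lo <= z0 <= hi ->
  filterlim g (within (fun z => lo <= z <= hi) (locally z0)) (locally (g z0)) ->
  (forall z, lo < z < hi -> g z = k) -> g z0 = k.
Proof.
intros Hlh Hz Hg Hk.
destruct (Req_dec (g z0) k) as [|Hne]; trivial; exfalso.
(* The ball of this radius about [g z0] excludes [k], so a single interior point close enough to
   [z0] gives a contradiction. *)
assert (He : 0 < Rabs (g z0 - k)) by (apply Rabs_pos_lt; lra).
destruct (Hg _ (locally_ball (g z0) (mkposreal _ He))) as [e Hd].
(* [z] moves from [z0] towards the midpoint by the fraction [s]: positivity of [s] makes [z]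
   interior, and the displacement is at most [s * (hi - lo) / 2], below [e]. *)
pose (s := Rmin 1 (e / (hi - lo))).
pose (z := z0 + s * ((lo + hi) / 2 - z0)).
assert (Hs0 : 0 < s)
  by (apply Rmin_pos; [lra | apply Rdiv_lt_0_compat; [apply cond_pos | lra]]).
assert (Hs1 : s <= 1) by apply Rmin_l.
assert (Hs2 : s * (hi - lo) <= e).
{ apply Rle_trans with (e / (hi - lo) * (hi - lo)).
  - apply Rmult_le_compat_r; [lra | apply Rmin_r].
  - right; field; lra. }
assert (Hzz : lo < z < hi) by (unfold z; nra).
assert (Hb : ball z0 e z).
{ apply Rabs_lt_between'; destruct e as [e He']; simpl in Hs2; simpl; unfold z; nra. }
specialize (Hd z Hb ltac:(lra)); rewrite (Hk z Hzz) in Hd.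
change (Rabs (k - g z0) < Rabs (g z0 - k)) in Hd.
rewrite Rabs_minus_sym in Hd; lra.
Qed.

Lemma field_continuous_line_z (D : region) (F : field) (x y z t : R) :
  field_continuous_on D F -> D x y z t ->
  filterlim (fun s => F x y s t) (within (fun s => D x y s t) (locally z))
    (locally (F x y z t)).
Proof.
intros HF Hp Q HQ.
destruct (HF (x, y, z, t) Hp Q HQ) as [e He].
exists e; intros s Hs HD; apply (He (x, y, s, t)); trivial.
repeat split; try apply ball_center; exact Hs.
Qed.

Lemma field_continuous_in (I D : region) (F : field) :
  region_open I -> (forall x y z t, I x y z t -> D x y z t) ->
  field_continuous_on D F -> continuous_in I F.
Proof.
intros HI HID HF [[[x y] z] t] Hp Q HQ.
change (locally (x, y, z, t) (fun p => Q (uncurry4 F p))).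
generalize (filter_and _ _ (HI _ Hp) (HF (x, y, z, t) (HID _ _ _ _ Hp) Q HQ)).
apply filter_imp; intros [[[a b] e] s] [H1 H2]; apply H2, HID, H1.
Qed.

Definition axis_family (Fx Fy Fz Ft : field) (i : axis) : field :=
  match i with axis_x => Fx | axis_y => Fy | axis_z => Fz | axis_t => Ft end.

Lemma Ck_upto_jet1 (I D : region) (F : field) (k : nat) :
  region_open I -> (forall x y z t, I x y z t -> D x y z t) ->
  Ck_upto I D (S k) F ->
  exists DF, jet1 I F DF /\ forall i, Ck_upto I D k (DF i).
Proof.
intros HI HID (HF & Fx & Fy & Fz & Ft & HD & Hx & Hy & Hz & Ht).
assert (HC : forall i, Ck_upto I D k (axis_family Fx Fy Fz Ft i))
  by (now intros []).
exists (axis_family Fx Fy Fz Ft); repeat split; trivial.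
- intros i x y z t Hp; destruct (HD _ _ _ _ Hp) as (H1 & H2 & H3 & H4).
  now destruct i.
- now apply field_continuous_in with D.
- intros i; apply field_continuous_in with D; trivial.
  (* [Ck_upto] unfolds only when [k] is a constructor; in both cases its first clause is the
     continuity wanted. *)
  specialize (HC i); destruct k; apply HC.
Qed.

Lemma Ck_upto_jet2 (I D : region) (F : field) :
  region_open I -> (forall x y z t, I x y z t -> D x y z t) ->
  Ck_upto I D 2 F -> exists DF DDF, jet2 I F DF DDF.
Proof.
intros HI HID HF.
destruct (Ck_upto_jet1 I D F 1 HI HID HF) as (DF & HDF & HC).
assert (J : forall i, exists DG, jet1 I (DF i) DG).
{ intros i; destruct (Ck_upto_jet1 I D (DF i) 0 HI HID (HC i)) as (DG & HG & _).
  now exists DG. }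
(* There are only four axes, so the second derivatives are picked one by one, without a choice
   axiom. *)
destruct (J axis_x) as [Gx Hx], (J axis_y) as [Gy Hy],
  (J axis_z) as [Gz Hz], (J axis_t) as [Gt Ht].
exists DF, (fun i => match i with
  axis_x => Gx | axis_y => Gy | axis_z => Gz | axis_t => Gt end).
split; trivial; now intros [].
Qed.

Lemma fluid_int_open (d c : R) (eta : R -> R) :
  (forall s, continuous eta s) -> region_open (fluid_int d c eta).
Proof.
intros Heta.
assert (Cz : forall p : R * R * R * R, continuous (fun p => snd (fst p)) p).
{ intros [[[x y] z] t].
  apply continuous_comp with (f := fun p : R * R * R * R => fst p) (g := snd);
    [apply continuous_fst | apply continuous_snd]. }
assert (Cx : forall p : R * R * R * R, continuous (fun p => fst (fst (fst p))) p).
{ intros [[[x y] z] t].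
  apply continuous_comp with (f := fun p : R * R * R * R => fst (fst p)) (g := fst);
    [|apply continuous_fst].
  apply continuous_comp with (f := fun p : R * R * R * R => fst p) (g := fst);
    apply continuous_fst. }
assert (Ct : forall p : R * R * R * R, continuous (fun p => snd p) p)
  by (intros [? ?]; apply continuous_snd).
apply open_ext with (fun p : R * R * R * R => - d < snd (fst p) /\
  0 < eta (fst (fst (fst p)) - c * snd p) - snd (fst p)).
{ intros [[[x y] z] t]; unfold fluid_int; simpl; split; intros [? ?]; lra. }
apply open_and.
- apply open_comp with (D := fun s => - d < s); [intros; apply Cz | apply open_gt].
- apply open_comp with
    (f := fun p : R * R * R * R => eta (fst (fst (fst p)) - c * snd p) - snd (fst p))
    (D := fun s => 0 < s); [|apply open_gt].
  intros p _.
  apply @continuous_minus; [|apply Cz].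
  apply continuous_comp with
    (f := fun p : R * R * R * R => fst (fst (fst p)) - c * snd p) (g := eta);
    [|apply Heta].
  apply @continuous_minus; [apply Cx|].
  apply (continuous_mult (fun _ => c) (fun p : R * R * R * R => snd p));
    [apply continuous_const | apply Ct].
Qed.

(** A profile without slope would be constant, equal to [eta 0 > 0], against the zero mean. *)
Lemma wave_profile_slope (d L : R) (eta : R -> R) :
  0 < L -> wave_profile d L eta -> exists s, Derive eta s <> 0.
Proof.
intros HL (HC2 & _ & _ & Hmean & _ & Hpos).
destruct (classic (exists s, Derive eta s <> 0)) as [|Hn]; trivial; exfalso.
assert (Hd : forall s, is_derive eta s 0).
{ intros s; destruct (Req_dec (Derive eta s) 0) as [<-|Hs];
    [apply Derive_correct, HC2 | elim Hn; now exists s]. }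
rewrite (RInt_ext _ (fun _ => eta 0)), RInt_const in Hmean.
- unfold scal in Hmean; simpl in Hmean; unfold mult in Hmean; simpl in Hmean; nra.
- intros s _; assert (E := derive_const_affine eta 0 Hd s).
  rewrite Rmult_0_l, Rplus_0_r in E; exact E.
Qed.

(** * Vorticity and velocity gradient *)

(* Unification in the two tactics below would otherwise unfold derivatives and
   diverge on mismatching fields. *)
Opaque is_partial continuous_in.

(** The derivative may be left as an existential variable and is then built from the shape of the
    field. Only sums and products are treated, so the fields below write differences as sums with
    negated coefficients. *)
Ltac prove_partial :=
  repeat first
    [ assumption
    | match goal with H : forall i : axis, is_partial _ i _ _ |- _ => apply H end
    | match goal with H : forall i j : axis, is_partial _ j _ _ |- _ => apply H end
    | apply is_partial_const | apply is_partial_coord_y | apply is_partial_coord_z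
    | eapply is_partial_plus | eapply is_partial_mult ].

Ltac prove_continuous :=
  repeat first
    [ match goal with H : forall i : axis, continuous_in _ _ |- _ => apply H end
    | match goal with H : forall i j : axis, continuous_in _ _ |- _ => apply H end
    | assumption
    | apply continuous_in_const | apply continuous_in_coord_y
    | apply continuous_in_plus | apply continuous_in_mult ].

Lemma jet2_mixed (I : region) (F : field) (D : axis -> field)
    (DD : axis -> axis -> field) (i j : axis) :
  region_open I -> i <> j -> jet2 I F D DD ->
  forall x y z t, I x y z t -> DD i j x y z t = DD j i x y z t.
Proof.
intros HI Hij [HF HD].
apply (mixed_partials I i j F (D i) (D j)); try assumption;
  try apply HF; try apply HD.
Qed.

Definition constant_curl (I : region) (U V W : axis -> field) (Y1 Y2 Y3 : R) : Prop :=
  forall x y z t, I x y z t ->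
    W axis_y x y z t - V axis_z x y z t = Y1 /\
    U axis_z x y z t - W axis_x x y z t = Y2 /\
    V axis_x x y z t - U axis_y x y z t = Y3.

Definition divergence_free (I : region) (U V W : axis -> field) : Prop :=
  forall x y z t, I x y z t ->
    U axis_x x y z t + V axis_y x y z t + W axis_z x y z t = 0.

(** Differentiating a constant vorticity component in time and exchanging derivatives shows that the
    time derivative of the velocity has zero curl. *)
Lemma mixed_partials_of_constant_difference (I : region) (i j : axis)
    (F G : field) (D E : axis -> field) (DD EE : axis -> axis -> field) (k : R) :
  region_open I -> i <> axis_t -> j <> axis_t -> jet2 I F D DD -> jet2 I G E EE ->
  (forall x y z t, I x y z t -> D i x y z t - E j x y z t = k) ->
  forall x y z t, I x y z t -> DD axis_t i x y z t = EE axis_t j x y z t.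
Proof.
intros HI Hi Hj HF HG Hk x y z t Hp.
rewrite (jet2_mixed I F D DD axis_t i), (jet2_mixed I G E EE axis_t j); auto.
apply (is_partial_unique I axis_t (D i)); [apply HF| |exact Hp].
apply is_partial_ext with (fun x y z t => E j x y z t + k)
  (fun x y z t => EE j axis_t x y z t + 0); try assumption.
- intros x' y' z' t' H; specialize (Hk _ _ _ _ H); lra.
- intros; lra.
- apply is_partial_plus; [apply HG | apply is_partial_const].
Qed.

(* [(a, b, g + beta y)] is the absolute vorticity. *)
Definition vorticity_transport (I : region) (a b g beta : R) (v : field)
    (U V W : axis -> field) : Prop :=
  forall x y z t, I x y z t ->
    a * U axis_x x y z t + b * U axis_y x y z t + (g + beta * y) * U axis_z x y z t = 0 /\
    a * V axis_x x y z t + b * V axis_y x y z t + (g + beta * y) * V axis_z x y z t = 0 /\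
    a * W axis_x x y z t + b * W axis_y x y z t + (g + beta * y) * W axis_z x y z t
      = beta * v x y z t.

(** The hypotheses on [Q] say that [grad Q] is the time derivative of the velocity plus the cross
    product of the absolute vorticity with the velocity. The transport equation is the curl of this
    identity. *)
Lemma vorticity_transport_of_gradient (I : region) (a b g beta Y1 Y2 Y3 : R)
    (u v w Q : field) (U V W : axis -> field) (UU VV WW : axis -> axis -> field) :
  region_open I -> jet2 I u U UU -> jet2 I v V VV -> jet2 I w W WW ->
  constant_curl I U V W Y1 Y2 Y3 -> divergence_free I U V W ->
  is_partial I axis_x Q (fun x y z t =>
    U axis_t x y z t + b * w x y z t + (- g + - beta * y) * v x y z t) ->
  is_partial I axis_y Q (fun x y z t =>
    V axis_t x y z t + (g + beta * y) * u x y z t + - a * w x y z t) ->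
  is_partial I axis_z Q (fun x y z t =>
    W axis_t x y z t + a * v x y z t + - b * u x y z t) ->
  vorticity_transport I a b g beta v U V W.
Proof.
intros HI Ju Jv Jw Hcurl Hdiv Qx Qy Qz x y z t Hp.
assert (E1 : WW axis_t axis_y x y z t = VV axis_t axis_z x y z t)
  by (apply (mixed_partials_of_constant_difference I axis_y axis_z w v W V WW VV Y1);
      auto; try discriminate; apply Hcurl).
assert (E2 : UU axis_t axis_z x y z t = WW axis_t axis_x x y z t)
  by (apply (mixed_partials_of_constant_difference I axis_z axis_x u w U W UU WW Y2);
      auto; try discriminate; apply Hcurl).
assert (E3 : VV axis_t axis_x x y z t = UU axis_t axis_y x y z t)
  by (apply (mixed_partials_of_constant_difference I axis_x axis_y v u V U VV UU Y3);
      auto; try discriminate; apply Hcurl).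
specialize (Hdiv _ _ _ _ Hp).
destruct Ju as [(Du & Cu & CU) JU], Jv as [(Dv & Cv & CV) JV],
  Jw as [(Dw & Cw & CW) JW].
assert (DU := fun i => proj1 (JU i)); assert (DV := fun i => proj1 (JV i));
  assert (DW := fun i => proj1 (JW i)); cbv beta in DU, DV, DW.
assert (CUU := fun i => proj2 (proj2 (JU i))); assert (CVV := fun i => proj2 (proj2 (JV i)));
  assert (CWW := fun i => proj2 (proj2 (JW i))); cbv beta in CUU, CVV, CWW.
(* The mixed partials [G] and [G'] remain arguments, to be found by unification in
   [prove_partial]. *)
assert (Sxy := fun G G' => mixed_partials I axis_x axis_y Q _ _ G G' HI
                 ltac:(discriminate) Qx Qy).
assert (Sxz := fun G G' => mixed_partials I axis_x axis_z Q _ _ G G' HI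
                 ltac:(discriminate) Qx Qz).
assert (Syz := fun G G' => mixed_partials I axis_y axis_z Q _ _ G G' HI
                 ltac:(discriminate) Qy Qz).
assert (R1 := Sxy _ _ ltac:(prove_partial) ltac:(prove_partial)
  ltac:(prove_continuous) ltac:(prove_continuous) _ _ _ _ Hp).
assert (R2 := Sxz _ _ ltac:(prove_partial) ltac:(prove_partial)
  ltac:(prove_continuous) ltac:(prove_continuous) _ _ _ _ Hp).
assert (R3 := Syz _ _ ltac:(prove_partial) ltac:(prove_partial)
  ltac:(prove_continuous) ltac:(prove_continuous) _ _ _ _ Hp).
cbv beta in R1, R2, R3; simpl in R1, R2, R3.
(* [R1], [R2], [R3] yield the third, second and first components: the time terms cancel by [E3],
   [E2], [E1], and [Hdiv] times the matching component of the absolute vorticity supplies the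
   missing derivative. *)
nra.
Qed.

Lemma gradient_rigidity (I : region) (f h beta Y1 Y2 Y3 : R) (u v w : field)
    (U V W : axis -> field) :
  region_open I -> beta <> 0 -> jet1 I u U -> jet1 I v V -> jet1 I w W ->
  constant_curl I U V W Y1 Y2 Y3 ->
  vorticity_transport I Y1 (Y2 + h) (Y3 + f) beta v U V W ->
  forall x y z t, I x y z t ->
    U axis_y x y z t = - Y3 /\ U axis_z x y z t = 0 /\
    V axis_x x y z t = 0 /\ V axis_y x y z t = W axis_z x y z t /\
    W axis_x x y z t = - Y2.
Proof.
intros HI Hb (Du & Cu & CU) (Dv & Cv & CV) (Dw & Cw & CW) Hcurl Htr.
pose (phi := fun x y z t => Y1 * u x y z t + (Y2 + h) * v x y z t
                            + (Y3 + f + beta * y) * w x y z t : R).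
assert (Px : is_partial I axis_x phi (fun _ y _ _ => h * Y3 + - Y2 * (f + beta * y))).
(* Each partial derivative of [phi] is a transport expression plus products of absolute vorticity
   with vorticity, in which the quadratic terms in [Y1], [Y2], [Y3] cancel; here
   [(Y2 + h) * Y3 - (Y3 + f + beta * y) * Y2] remains. *)
{ eapply is_partial_ext; [exact HI | reflexivity | | unfold phi; prove_partial].
  intros x y z t Hp; destruct (Hcurl _ _ _ _ Hp) as (A1 & A2 & A3).
  destruct (Htr _ _ _ _ Hp) as (B1 & B2 & B3); simpl; nra. }
assert (Py : is_partial I axis_y phi (fun x y z t => Y1 * (f + beta * y) + beta * w x y z t)).
{ eapply is_partial_ext; [exact HI | reflexivity | | unfold phi; prove_partial].
  intros x y z t Hp; destruct (Hcurl _ _ _ _ Hp) as (A1 & A2 & A3).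
  destruct (Htr _ _ _ _ Hp) as (B1 & B2 & B3); simpl; nra. }
assert (Pz : is_partial I axis_z phi (fun x y z t => - Y1 * h + beta * v x y z t)).
{ eapply is_partial_ext; [exact HI | reflexivity | | unfold phi; prove_partial].
  intros x y z t Hp; destruct (Hcurl _ _ _ _ Hp) as (A1 & A2 & A3).
  destruct (Htr _ _ _ _ Hp) as (B1 & B2 & B3); simpl; nra. }
intros x y z t Hp.
assert (Sxy := fun G G' => mixed_partials I axis_x axis_y phi _ _ G G' HI
                 ltac:(discriminate) Px Py).
assert (Sxz := fun G G' => mixed_partials I axis_x axis_z phi _ _ G G' HI
                 ltac:(discriminate) Px Pz).
assert (Syz := fun G G' => mixed_partials I axis_y axis_z phi _ _ G G' HI
                 ltac:(discriminate) Py Pz).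
assert (R1 := Sxy _ _ ltac:(prove_partial) ltac:(prove_partial)
  ltac:(prove_continuous) ltac:(prove_continuous) _ _ _ _ Hp).
assert (R2 := Sxz _ _ ltac:(prove_partial) ltac:(prove_partial)
  ltac:(prove_continuous) ltac:(prove_continuous) _ _ _ _ Hp).
assert (R3 := Syz _ _ ltac:(prove_partial) ltac:(prove_partial)
  ltac:(prove_continuous) ltac:(prove_continuous) _ _ _ _ Hp).
cbv beta in R1, R2, R3; simpl in R1, R2, R3.
destruct (Hcurl _ _ _ _ Hp) as (A1 & A2 & A3).
(* Each comparison of mixed partials of [phi] carries a factor [beta], which is cancelled. *)
assert (Wx : W axis_x x y z t = - Y2)
  by (apply (Rmult_eq_reg_l beta); [lra | exact Hb]).
assert (Vx : V axis_x x y z t = 0)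
  by (apply (Rmult_eq_reg_l beta); [lra | exact Hb]).
assert (VW : V axis_y x y z t = W axis_z x y z t)
  by (apply (Rmult_eq_reg_l beta); [lra | exact Hb]).
repeat split; lra.
Qed.

Lemma momentum_vorticity_transport (f h Rad g rho d c Y1 Y2 Y3 : R) (eta : R -> R)
    (u v w P : field) (U V W PP : axis -> field) (UU VV WW : axis -> axis -> field) :
  let I := fluid_int d c eta in
  region_open I -> jet2 I u U UU -> jet2 I v V VV -> jet2 I w W WW -> jet1 I P PP ->
  momentum f h Rad g rho d c eta u v w P ->
  constant_curl I U V W Y1 Y2 Y3 -> divergence_free I U V W ->
  vorticity_transport I Y1 (Y2 + h) (Y3 + f) (h / Rad) v U V W.
Proof.
intros I HI Ju Jv Jw JP Hm Hcurl Hdiv.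
assert (Euler : forall x y z t, I x y z t ->
  - / rho * PP axis_x x y z t
  = U axis_t x y z t + u x y z t * U axis_x x y z t + v x y z t * U axis_y x y z t
    + w x y z t * U axis_z x y z t + h * w x y z t - (f + h / Rad * y) * v x y z t /\
  - / rho * PP axis_y x y z t
  = V axis_t x y z t + u x y z t * V axis_x x y z t + v x y z t * V axis_y x y z t
    + w x y z t * V axis_z x y z t + (f + h / Rad * y) * u x y z t
    + h ^ 2 / 4 * y + h * f / 4 * Rad /\
  - / rho * PP axis_z x y z t
  = W axis_t x y z t + u x y z t * W axis_x x y z t + v x y z t * W axis_y x y z t
    + w x y z t * W axis_z x y z t - h * u x y z t - h ^ 2 / 4 * Rad + g).
{ intros x y z t Hp; specialize (Hm x y z t Hp); unfold material in Hm.
  destruct (jet1_Derive I u U x y z t (proj1 Ju) Hp) as (Eu1 & Eu2 & Eu3 & Eu4).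
  destruct (jet1_Derive I v V x y z t (proj1 Jv) Hp) as (Ev1 & Ev2 & Ev3 & Ev4).
  destruct (jet1_Derive I w W x y z t (proj1 Jw) Hp) as (Ew1 & Ew2 & Ew3 & Ew4).
  destruct (jet1_Derive I P PP x y z t JP Hp) as (EP1 & EP2 & EP3 & _).
  rewrite Eu1, Eu2, Eu3, Eu4, Ev1, Ev2, Ev3, Ev4, Ew1, Ew2, Ew3, Ew4, EP1, EP2, EP3 in Hm.
  unfold Rdiv in *; rewrite Rmult_1_l in Hm; repeat split; lra. }
(* Bernoulli head: since the vorticity is constant, [u . grad u] is
   [grad (|u|^2 / 2)] plus the Coriolis-like term [curl u x u]. *)
pose (N := fun x y z t => - / rho * P x y z t
  + (- / 2) * (u x y z t * u x y z t + v x y z t * v x y z t + w x y z t * w x y z t)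
  + (- (h ^ 2 / 8) * (y * y) + (- (h * f / 4 * Rad)) * y + (h ^ 2 / 4 * Rad - g) * z) : R).
assert (Du := proj1 (proj1 Ju)); assert (Dv := proj1 (proj1 Jv));
  assert (Dw := proj1 (proj1 Jw)); assert (DP := proj1 JP).
apply (vorticity_transport_of_gradient I _ _ _ _ Y1 Y2 Y3 u v w N U V W UU VV WW); trivial;
  (* The same script serves the three axes. Expanding [Y1], [Y2], [Y3] turns the goal into an
     algebraic identity; abstracting [h / Rad] keeps [field] from asking for [Rad <> 0]. *)
  (eapply is_partial_ext; [exact HI | reflexivity | | unfold N; prove_partial];
   intros x y z t Hp; destruct (Hcurl _ _ _ _ Hp) as (A1 & A2 & A3);
   destruct (Euler _ _ _ _ Hp) as (B1 & B2 & B3); simpl if_y; simpl if_z; cbv beta;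
   [rewrite B1 || rewrite B2 || rewrite B3]; rewrite <- ?A1, <- ?A2, <- ?A3;
   generalize (h / Rad); intros; field).
Qed.

(** * Bounded flows *)

Lemma partials_of_zero (I : region) (F : field) (D : axis -> field) :
  region_open I -> (forall i, is_partial I i F (D i)) ->
  (forall x y z t, I x y z t -> F x y z t = 0) ->
  forall i x y z t, I x y z t -> D i x y z t = 0.
Proof.
intros HI HD H0 i.
apply (is_partial_unique I i F (D i) (fun _ _ _ _ => 0)); trivial.
apply is_partial_ext with (fun _ _ _ _ => 0) (fun _ _ _ _ => 0); trivial.
- now intros; rewrite H0.
- apply is_partial_const.
Qed.

(** Derivatives are known only in the interior, while the kinematic conditions live on the boundary;
    continuity up to the boundary extends the constancy to the closed column. *)
Lemma vertical_constant (d c : R) (eta : R -> R) (F : field) (x y t : R) :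
  - d < eta (x - c * t) ->
  field_continuous_on (fluid d c eta) F ->
  is_partial (fluid_int d c eta) axis_z F (fun _ _ _ _ => 0) ->
  forall z z', fluid d c eta x y z t -> fluid d c eta x y z' t ->
  F x y z t = F x y z' t.
Proof.
intros Hd HC HF.
pose (m := (- d + eta (x - c * t)) / 2).
assert (H : forall z, fluid d c eta x y z t -> F x y z t = F x y m t).
{ intros z Hz.
  apply (closed_interval_limit (fun s => F x y s t) (- d) (eta (x - c * t)));
    trivial.
  - exact (field_continuous_line_z _ F x y z t HC Hz).
  - intros s Hs.
    apply (is_partial_line_z (fluid_int d c eta) F x y t (- d) (eta (x - c * t)));
      trivial; unfold m; lra. }
intros z z' Hz Hz'; now rewrite (H z), (H z').
Qed.

Lemma bounded_flow_horizontal (d c f h beta Y1 Y2 Y3 : R) (eta : R -> R)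
    (u v w : field) (U V W : axis -> field) :
  let I := fluid_int d c eta in
  region_open I -> beta <> 0 -> jet1 I u U -> jet1 I v V -> jet1 I w W ->
  constant_curl I U V W Y1 Y2 Y3 -> divergence_free I U V W ->
  vorticity_transport I Y1 (Y2 + h) (Y3 + f) beta v U V W ->
  field_continuous_on (fluid d c eta) w ->
  kinematic_bed d w -> bounded_velocity d c eta u v w ->
  forall x y z t, I x y z t ->
    U axis_z x y z t = 0 /\ v x y z t = 0 /\ w x y z t = 0.
Proof.
intros I HI Hb Ju Jv Jw Hcurl Hdiv Htr Cw Hbed Hbd x0 y0 z0 t0 Hp0.
assert (HID : forall x y z t, I x y z t -> fluid d c eta x y z t)
  by (unfold I, fluid, fluid_int; intros; lra).
assert (Hinv : y_invariant I) by (intros x y y' z t; trivial).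
assert (Hrig := gradient_rigidity I f h beta Y1 Y2 Y3 u v w U V W HI Hb Ju Jv Jw Hcurl Htr).
destruct Ju as (Du & _ & _), Jv as (Dv & _ & _), Jw as (Dw & _ & _).
(* The way boundedness enters, applied in turn to [u], [v] and [w]. *)
assert (Hline : forall (F : field) (D : axis -> field) x z t k M, I x 0 z t ->
  (forall i, is_partial I i F (D i)) ->
  (forall y, Rabs (F x y z t) <= M) -> (forall y, D axis_y x y z t = k) -> k = 0).
{ intros F D x z t k M Hp HD HM Hk.
  apply bounded_derive_const with (fun s => F x s z t) M; trivial.
  apply is_partial_line_y with I (D axis_y); trivial. }
assert (HY3 : Y3 = 0).
{ destruct (Hbd t0) as [M HM].
  assert (- Y3 = 0); [|lra].
  apply (Hline u U x0 z0 t0 _ M); trivial; intros y; apply (Hinv x0 y0 y) in Hp0.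
  - apply (HM x0 y z0), HID, Hp0.
  - apply Hrig, Hp0. }
assert (Uy0 : is_partial I axis_y u (fun _ _ _ _ => 0)).
{ apply is_partial_ext with u (U axis_y); trivial.
  intros x y z t Hp; destruct (Hrig _ _ _ _ Hp); lra. }
assert (Vy : forall x y z t, I x y z t -> V axis_y x y z t = 0).
{ intros x y z t Hp.
  destruct (Hbd t) as [M HM].
  apply (Hline v V x z t _ M); trivial; intros y'; apply (Hinv x y y') in Hp as Hp'.
  - apply (HM x y' z), HID, Hp'.
  (* Incompressibility and [v_y = w_z] give [2 v_y = - u_x], and [u_x] does not depend on [y]
     because [u] does not. Hence [v_y] is constant along the line. *)
  - destruct (Hrig _ _ _ _ Hp) as (_ & _ & _ & E1 & _).
    destruct (Hrig _ _ _ _ Hp') as (_ & _ & _ & E2 & _).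
    assert (E3 := Hdiv _ _ _ _ Hp); assert (E4 := Hdiv _ _ _ _ Hp').
    assert (E5 : U axis_x x y z t = U axis_x x y' z t)
      by (apply (partial_y_invariant I axis_x u); trivial; discriminate).
    lra. }
assert (Vy0 : is_partial I axis_y v (fun _ _ _ _ => 0)).
{ apply is_partial_ext with v (V axis_y); trivial. }
assert (Vz : forall x y z t, I x y z t -> V axis_z x y z t = 0).
{ intros x y z t Hp.
  (* at this [y'] the vertical component of the absolute vorticity is 1 *)
  pose (y' := (1 - (Y3 + f)) / beta).
  rewrite (partial_y_invariant I axis_z v (V axis_z)) with (y' := y'); trivial;
    try discriminate.
  apply (Hinv x y y') in Hp.
  destruct (Htr _ _ _ _ Hp) as (_ & E & _); destruct (Hrig _ _ _ _ Hp) as (_ & _ & E' & _).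
  rewrite E', (Vy _ _ _ _ Hp) in E.
  replace (Y3 + f + beta * y') with 1 in E by (unfold y'; field; exact Hb).
  lra. }
assert (HY1 : Y1 = 0).
{ destruct (Hbd t0) as [M HM].
  apply (Hline w W x0 z0 t0 _ M); trivial; intros y; apply (Hinv x0 y0 y) in Hp0.
  - apply (HM x0 y z0), HID, Hp0.
  (* As [v_z = 0], the first vorticity component is the slope [w_y]. *)
  - destruct (Hcurl _ _ _ _ Hp0) as (E & _); rewrite (Vz _ _ _ _ Hp0) in E; lra. }
assert (Wz0 : is_partial I axis_z w (fun _ _ _ _ => 0)).
{ apply is_partial_ext with w (W axis_z); trivial.
  intros x y z t Hp; destruct (Hrig _ _ _ _ Hp) as (_ & _ & _ & E & _).
  rewrite <- E; now apply Vy. }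
destruct (Hrig _ _ _ _ Hp0) as (_ & E1 & _ & E2 & _).
destruct (Htr _ _ _ _ Hp0) as (_ & _ & E3).
destruct (Hcurl _ _ _ _ Hp0) as (E4 & _).
rewrite (Vz _ _ _ _ Hp0) in E4; rewrite (Vy _ _ _ _ Hp0) in E2.
repeat split; trivial.
(* In the third transport equation [Y1], [w_y] and [w_z] all vanish, leaving [beta * v = 0]. *)
- apply (Rmult_eq_reg_l beta); trivial.
  rewrite <- E3, <- E2, HY1; replace (W axis_y x0 y0 z0 t0) with 0 by lra; ring.
- rewrite <- (Hbed x0 y0 t0).
  unfold I, fluid_int in Hp0.
  apply (vertical_constant d c eta); trivial; unfold fluid; lra.
Qed.

(** * Pressure on the free surface and the contradiction *)

Theorem theorem4p5 (Omega Rad g rho Patm sigma d c L phi : R)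
    (hOmega : 0 < Omega) (hRad : 0 < Rad) (hg : 0 < g) (hrho : 0 < rho)
    (hsigma : 0 < sigma) (hd : 0 < d) (hc : 0 < c) (hL : 0 < L)
    (hphi : - (PI / 2) < phi < PI / 2)
    (Y1 Y2 Y3 : R) (hY2 : Y2 + coriolis_fhat Omega phi <> 0) :
  ~ exists (u v w P : field) (eta : R -> R),
      solution Omega Rad g rho Patm sigma d c L phi u v w P eta /\
      constant_vorticity d c eta u v w Y1 Y2 Y3 /\
      bounded_velocity d c eta u v w.
Proof.
intros (u & v & w & P & eta & (Hwave & (Cu & Cv & Cw & CP) & Hm & Hinc & Hdyn & Hkin & Hbed)
  & Hvort & Hbd).
pose (I := fluid_int d c eta).
assert (Hdeta : forall s, - d < eta s) by apply Hwave.
assert (HI : region_open I).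
{ apply fluid_int_open; intros s; apply (ex_derive_continuous eta), (proj1 Hwave s). }
assert (HID : forall x y z t, I x y z t -> fluid d c eta x y z t)
  by (unfold I, fluid, fluid_int; intros; lra).
destruct (Ck_upto_jet2 I _ u HI HID Cu) as (U & UU & Ju).
destruct (Ck_upto_jet2 I _ v HI HID Cv) as (V & VV & Jv).
destruct (Ck_upto_jet2 I _ w HI HID Cw) as (W & WW & Jw).
destruct (Ck_upto_jet1 I _ P 0 HI HID CP) as (PP & JP & _).
assert (Hcurl : constant_curl I U V W Y1 Y2 Y3).
{ intros x y z t Hp.
  destruct (jet1_Derive I u U x y z t (proj1 Ju) Hp) as (Eu1 & Eu2 & Eu3 & _).
  destruct (jet1_Derive I v V x y z t (proj1 Jv) Hp) as (Ev1 & Ev2 & Ev3 & _).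
  destruct (jet1_Derive I w W x y z t (proj1 Jw) Hp) as (Ew1 & Ew2 & Ew3 & _).
  assert (E := Hvort x y z t Hp); rewrite Ew2, Ev3, Eu3, Ew1, Ev1, Eu2 in E; exact E. }
assert (Hdiv : divergence_free I U V W).
{ intros x y z t Hp.
  destruct (jet1_Derive I u U x y z t (proj1 Ju) Hp) as (Eu1 & Eu2 & Eu3 & _).
  destruct (jet1_Derive I v V x y z t (proj1 Jv) Hp) as (Ev1 & Ev2 & Ev3 & _).
  destruct (jet1_Derive I w W x y z t (proj1 Jw) Hp) as (Ew1 & Ew2 & Ew3 & _).
  assert (E := Hinc x y z t Hp); rewrite Eu1, Ev2, Ew3 in E; exact E. }
assert (Htr := momentum_vorticity_transport _ _ Rad g rho d c Y1 Y2 Y3 eta u v w P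
  U V W PP UU VV WW HI Ju Jv Jw JP Hm Hcurl Hdiv).
assert (Hh : 0 < coriolis_fhat Omega phi).
{ unfold coriolis_fhat; apply Rmult_lt_0_compat; [lra | apply cos_gt_0; lra]. }
set (h := coriolis_fhat Omega phi) in *; set (f := coriolis_f Omega phi) in *.
assert (Hb : 0 < h / Rad) by (now apply Rdiv_lt_0_compat).
assert (Hflow := bounded_flow_horizontal d c f h (h / Rad) Y1 Y2 Y3 eta u v w U V W HI
  ltac:(lra) (proj1 Ju) (proj1 Jv) (proj1 Jw) Hcurl Hdiv Htr (proj1 Cw) Hbed Hbd).
(* All partials of [v] vanish too, so its material derivative drops out of the second momentum
   equation. *)
assert (Hv0 := partials_of_zero I v V HI (proj1 (proj1 Jv))
  (fun x y z t Hp => proj1 (proj2 (Hflow x y z t Hp)))).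
assert (Hw0 := partials_of_zero I w W HI (proj1 (proj1 Jw))
  (fun x y z t Hp => proj2 (proj2 (Hflow x y z t Hp)))).
destruct (wave_profile_slope d L eta hL Hwave) as [s0 Hs0].
(* In the column over [s0] at time 0, both [u] and [w] are constant in [z]. With [w = 0] and a
   nonzero slope, the kinematic condition forces [u = c] at the surface, hence throughout. *)
assert (Huc : forall y z, I s0 y z 0 -> u s0 y z 0 = c).
{ intros y z Hp.
  assert (Hsurf : fluid d c eta s0 y (eta (s0 - c * 0)) 0)
    by (generalize (Hdeta (s0 - c * 0)); unfold fluid; lra).
  rewrite (vertical_constant d c eta u s0 y 0) with (z' := eta (s0 - c * 0));
    trivial; try apply Hdeta; try apply HID; trivial; try apply Cu.
  - assert (K := Hkin s0 y 0); simpl in K.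
    rewrite (vertical_constant d c eta w s0 y 0) with (z' := - d) in K;
      trivial; try apply Hdeta; try apply Cw.
    + rewrite Hbed in K; replace (s0 - c * 0) with s0 in * by ring.
      apply Rminus_diag_uniq.
      symmetry in K; apply Rmult_integral in K; destruct K; [assumption | contradiction].
    + apply is_partial_ext with w (W axis_z); trivial; [apply Hw0 | apply Jw].
    + generalize (Hdeta (s0 - c * 0)); unfold fluid; lra.
  - apply is_partial_ext with u (U axis_z); trivial;
      [intros; now apply Hflow | apply Ju]. }
(* With [v = w = 0] and [u = c], the second momentum equation reads [P_y = - rho * (A + B * y)]. *)
pose (A := f * c + h * f / 4 * Rad); pose (B := h / Rad * c + h ^ 2 / 4).
assert (HP : forall y z, I s0 0 z 0 ->
  P s0 y z 0 - P s0 0 z 0 = - rho * (A * y + B * y ^ 2 / 2)).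
{ intros y z Hp.
  assert (Hd : forall r : R, is_derive
    (fun r => P s0 r z 0 + rho * (A * r + B * (r * r) / 2)) r 0).
  { intros r.
    assert (Hr : I s0 r z 0) by exact Hp.
    assert (E := proj1 (proj2 (Hm s0 r z 0 Hr))); unfold material in E.
    destruct (jet1_Derive I v V s0 r z 0 (proj1 Jv) Hr) as (E1 & E2 & E3 & E4).
    destruct (jet1_Derive I P PP s0 r z 0 JP Hr) as (_ & E5 & _).
    rewrite E1, E2, E3, E4, E5, !Hv0, (Huc _ _ Hr) in E by exact Hr.
    assert (E6 : PP axis_y s0 r z 0 = - rho * (A + B * r)).
    { unfold A, B; replace (PP axis_y s0 r z 0)
        with (- rho * (- (1 / rho) * PP axis_y s0 r z 0)) by (field; lra).
      rewrite <- E; ring. }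
    evar_last.
    - apply (is_derive_plus (fun r => P s0 r z 0)
        (fun r => rho * (A * r + B * (r * r) / 2)) r (PP axis_y s0 r z 0) (rho * (A + B * r)));
        [exact (proj1 JP axis_y _ _ _ _ Hr)|].
      auto_derive; trivial; field.
    - change (PP axis_y s0 r z 0 + rho * (A + B * r) = 0); rewrite E6; ring. }
  assert (E := derive_const_affine _ 0 Hd y); cbv beta in E.
  replace (y ^ 2) with (y * y) by ring; lra. }
(* The interior formula for the pressure difference passes to the surface by continuity in [z];
   there the difference is zero, since the dynamic condition does not involve [y]. *)
assert (Hsurf : forall y, A * y + B * y ^ 2 / 2 = 0).
{ intros y.
  assert (Hs : forall y, fluid d c eta s0 y (eta (s0 - c * 0)) 0)
    by (intros; generalize (Hdeta (s0 - c * 0)); unfold fluid; lra).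
  assert (E := closed_interval_limit (fun z => P s0 y z 0 - P s0 0 z 0) (- d)
    (eta (s0 - c * 0)) (eta (s0 - c * 0)) (- rho * (A * y + B * y ^ 2 / 2))
    (Hdeta _)); cbv beta in E.
  assert (E0 := Hdyn s0 y 0); assert (E1 := Hdyn s0 0 0); simpl in E0, E1.
  rewrite <- E1 in E0.
  assert (E2 : 0 = - rho * (A * y + B * y ^ 2 / 2)).
  { rewrite <- (Rminus_diag_eq _ _ E0); apply E.
    - generalize (Hdeta (s0 - c * 0)); lra.
    - eapply (filterlim_comp_2 (fun z => P s0 y z 0) (fun z => - P s0 0 z 0) plus).
      + exact (field_continuous_line_z _ P s0 y _ 0 (proj1 CP) (Hs y)).
      + eapply (filterlim_comp _ _ _ (fun z => P s0 0 z 0) opp).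
        * exact (field_continuous_line_z _ P s0 0 _ 0 (proj1 CP) (Hs 0)).
        * apply (filterlim_opp (P s0 0 (eta (s0 - c * 0)) 0)).
      + apply (filterlim_plus (P s0 y (eta (s0 - c * 0)) 0)
          (- P s0 0 (eta (s0 - c * 0)) 0)).
    - intros z Hz; apply HP; exact Hz. }
  apply (Rmult_eq_reg_l (- rho)); lra. }
(* Adding the values at 1 and -1 eliminates [A] and gives [B = 0]. *)
assert (H1 := Hsurf 1); assert (H2 := Hsurf (-1)).
assert (0 < B) by (unfold B; apply Rplus_lt_0_compat; nra).
lra.
Qed.
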